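(* For every safe linear bandit (SLB) algorithm, there exists a $1/8$-well-separated SLB instance on which the algorithm must incur $$\max\big(\mathbb{E}[\mathscr{E}_T],\ \mathbb{E}[\mathscr{S}_T]\big)=\Omega(\sqrt{T}).$$
   Context: Safe linear bandit (SLB) setting. An SLB instance consists of integers $d,U\ge 1$, $K\ge 0$, $m=U+K$; a known bounded polytope $\mathcal{X}=\{x\in\mathbb{R}^d: Bx\le\beta\}$ ($B$ has $K$ rows) contained in $\{\|x\|\le 1\}$; an unknown $\theta\in\mathbb{R}^d$; a matrix $A\in\mathbb{R}^{m\times d}$ with rows $a^1,\dots,a^m$ whose first $U$ rows are unknown and whose last $K$ rows are those of $B$; and a known vector $\alpha\in\mathbb{R}^m$ whose last $K$ entries are $\beta$. It is assumed that $\|\theta\|\le 1$, $\|a^i\|\le 1$ for all $i$, and that $\mathcal{S}=\{x:Ax\le\alpha\}$ is nonempty. Let $x^*$ be the constrained optimum, i.e. the maximiser of $\langle\theta,x\rangle$ over $\mathcal{S}$. In each round $t=1,2,\dots$ the learner (the SLB algorithm) chooses $x_t\in\mathcal{X}$ based on the history $\mathscr{H}_{t-1}$ of past actions and feedback, and observes $r_t=\langle\theta,x_t\rangle+w_t^R$ and $s_t^i=\langle a^i,x_t\rangle+w_t^{S,i}$ for $1\le i\le U$. The noise vector $w_t=(w_t^R,(w_t^{S,i})_{i\le U})$ satisfies $\mathbb{E}[w_t\mid\mathcal{F}_t]=0$ and $\mathbb{E}[e^{\lambda^\top w_t}\mid\mathcal{F}_t]\le e^{\|\lambda\|^2/2}$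 for all $\lambda$, where $\mathcal{F}_t=\sigma(\mathscr{H}_{t-1},x_t)$. Metrics over $T$ rounds, with $(z)_+=\max(z,0)$: efficacy regret $\mathscr{E}_T=\sum_{t\le T}(\langle\theta,x^*-x_t\rangle)_+$ and net safety violation $\mathscr{S}_T=\sum_{t\le T}\big(\max_i (\langle a^i,x_t\rangle-\alpha^i)\big)_+$. Well-separated: let $\mathcal{E}$ be the union of the set of extreme points of $\mathcal{S}$ and the set of extreme points of $\mathcal{X}$. The instance is $\Delta$-well-separated if every $x\in\mathcal{E}\setminus\{x^*\}$ is either feasible ($x\in\mathcal{S}$) with $\langle\theta,x^*-x\rangle\ge\Delta$, or infeasible with $\max_i(\langle a^i,x\rangle-\alpha^i)\ge\Delta$. *)

(* Defs.v *)
From HB Require Import structures.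
From mathcomp Require Import all_boot all_order all_algebra.
From mathcomp Require Import all_classical all_reals all_analysis.
From mathcomp Require Import measurable_realfun.

Set Implicit Arguments.
Unset Strict Implicit.
Unset Printing Implicit Defensive.
Import Order.TTheory GRing.Theory Num.Theory.
Import numFieldNormedType.Exports.

Local Open Scope classical_set_scope.
Local Open Scope ring_scope.

(* Vectors of R^n are n.-tuple R, which the library equips with the product
   sigma-algebra, that is the Borel sigma-algebra of R^n. *)
Section euclidean.
Context {R : realType} {n : nat}.
Implicit Types x y z : n.-tuple R.

Definition dot x y : R := \sum_(i < n) tnth x i * tnth y i.

Definition norm2 x : R := Num.sqrt (dot x x).

Definition convex_comb (l : R) y z : n.-tuple R :=
  [tuple l * tnth y i + (1 - l) * tnth z i | i < n].

Definition extreme_point (C : set (n.-tuple R)) x : Prop :=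
  C x /\ forall (l : R) y z, 0 < l < 1 -> C y -> C z ->
    x = convex_comb l y z -> y = x /\ z = x.

Definition polyhedron {k : nat} (M : k.-tuple (n.-tuple R)) (b : k.-tuple R) :
    set (n.-tuple R) :=
  [set x | forall i : 'I_k, dot (tnth M i) x <= tnth b i].

End euclidean.

Section probability_kernels.
Context d1 d2 d3 (X : measurableType d1) (Y : measurableType d2)
  (Z : measurableType d3) (R : realType).
Local Open Scope ereal_scope.

(* The library makes mkcomp an s-finite kernel only. *)
Section pkcomp.
Variables (l : R.-pker X ~> Y) (k : R.-pker (X * Y) ~> Z).

Definition pkcomp : X -> {measure set Z -> \bar R} := mkcomp l k.

Let measurable_pkcomp U : measurable U -> measurable_fun [set: X] (pkcomp ^~ U).
Proof. exact: measurable_fun_mkcomp_sfinite. Qed.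

HB.instance Definition _ := isKernel.Build _ _ _ _ _ pkcomp measurable_pkcomp.

Let pkcomp_prob x : pkcomp x [set: Z] = 1.
Proof.
rewrite /pkcomp /= /kcomp (eq_integral (cst 1)).
  by rewrite integral_cst// mul1e prob_kernel.
by move=> y _; rewrite prob_kernel.
Qed.

HB.instance Definition _ := Kernel_isProbability.Build _ _ _ _ _
  pkcomp pkcomp_prob.
End pkcomp.

Section pbind.
Variables (P : probability X R) (k : R.-pker X ~> Y).

Definition pbind (A : set Y) : \bar R := \int[P]_x k x A.

Let pbind0 : pbind set0 = 0.
Proof.
by rewrite /pbind (eq_integral (cst 0)) ?integral0// => x _; rewrite measure0.
Qed.

Let pbind_ge0 A : 0 <= pbind A. Proof. exact: integral_ge0. Qed.

Let pbind_sigma_additive : semi_sigma_additive pbind.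
Proof.
move=> A mA tA mUA; rewrite [X in _ --> X](_ : _ =
  \int[P]_x (\sum_(n <oo) k x (A n))); last first.
  apply: eq_integral => x _.
  by apply/esym/cvg_lim => //; exact/measure_semi_sigma_additive.
apply/cvg_closeP; split.
  by apply: is_cvg_nneseries => n _ _; exact: integral_ge0.
by rewrite closeE// integral_nneseries// => n; exact: measurable_kernel.
Qed.

HB.instance Definition _ := isMeasure.Build _ _ R pbind
  pbind0 pbind_ge0 pbind_sigma_additive.

Let pbindT : pbind [set: Y] = 1.
Proof.
rewrite /pbind (eq_integral (cst 1)).
  rewrite integral_cst// mul1e. exact: probability_setT.
by move=> x _; rewrite prob_kernel.
Qed.

HB.instance Definition _ := Measure_isProbability.Build _ _ R pbind pbindT.
End pbind.

End probability_kernels.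

Definition action (R : realType) (d : nat) := d.-tuple R.

(* One real for the reward and one per unknown constraint; used both for the
   noise (w^R, w^S) and for the feedback (r, s). *)
Definition signal (R : realType) (U : nat) := (R * U.-tuple R)%type.

(* Actions and feedback of t rounds, the most recent round first. *)
Definition history (R : realType) (d U t : nat) :=
  t.-tuple (action R d * signal R U).

(* What the learner is given beforehand. *)
Record slb_known (R : realType) := SLBKnown {
  dim : nat;
  unk : nat;
  kno : nat;
  dim_gt0 : (0 < dim)%N;
  unk_gt0 : (0 < unk)%N;
  Bmat : kno.-tuple (dim.-tuple R);
  beta : kno.-tuple R;
  alpha_unk : unk.-tuple R;
  domain : set (dim.-tuple R) := polyhedron Bmat beta;
  domain_ball : domain `<=` [set x | norm2 x <= 1];
  (* Implied by the nonemptiness of the feasible set; it is stated here because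
     otherwise no algorithm could play inside the domain. *)
  domain_neq0 : domain !=set0 }.
Arguments domain {R} s x.

Definition alpha (R : realType) (k : slb_known R) : (unk k + kno k).-tuple R :=
  [tuple of alpha_unk k ++ beta k].

(* The conditional law of x_{t+1} given the history of the first t rounds; the
   learner may randomise. *)
Record slb_policy (R : realType) (k : slb_known R) := SLBPolicy {
  play : forall t, R.-pker history R (dim k) (unk k) t ~> action R (dim k);
  play_domain : forall t h, play t h (domain k) = 1%E }.

Definition slb_algorithm (R : realType) := forall k : slb_known R, slb_policy k.

(* The conditional law of the noise vector of round t+1 given F_{t+1}, i.e.
   given the history of the first t rounds and the action of round t+1. *)
Definition slb_noise (R : realType) (d U : nat) :=
  forall t, R.-pker (history R d U t * action R d) ~> signal R U.

Definition centered (R : realType) (U : nat)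
    (P : {measure set (signal R U) -> \bar R}) : Prop :=
  (\int[P]_w (w.1)%:E = 0 /\
   forall i : 'I_U, \int[P]_w (tnth w.2 i)%:E = 0)%E.

Definition sub_gaussian (R : realType) (U : nat)
    (P : {measure set (signal R U) -> \bar R}) : Prop :=
  forall l : signal R U,
    (\int[P]_w (expR (l.1 * w.1 + dot l.2 w.2))%:E <=
     (expR ((l.1 ^+ 2 + dot l.2 l.2) / 2))%:E)%E.

Record slb_instance (R : realType) := SLBInstance {
  known :> slb_known R;
  theta : (dim known).-tuple R;
  A_unk : (unk known).-tuple ((dim known).-tuple R);
  Amat : (unk known + kno known).-tuple ((dim known).-tuple R) :=
    [tuple of A_unk ++ Bmat known];
  feasible : set ((dim known).-tuple R) := polyhedron Amat (alpha known);
  xstar : (dim known).-tuple R;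
  noise : slb_noise R (dim known) (unk known);
  theta_le1 : norm2 theta <= 1;
  Amat_le1 : forall i, norm2 (tnth Amat i) <= 1;
  xstar_feasible : feasible xstar;
  xstar_max : forall x, feasible x -> dot theta x <= dot theta xstar;
  noise_centered : forall t h x, domain known x -> centered (noise t (h, x));
  noise_sub_gaussian : forall t h x, domain known x ->
    sub_gaussian (noise t (h, x)) }.
Arguments feasible {R} s x.

Section instance.
Context {R : realType}.
Variable I : slb_instance R.
Implicit Type x : (dim I).-tuple R.

Definition gap x : R := dot (theta I) (xstar I) - dot (theta I) x.

Definition slack x (i : 'I_(unk I + kno I)) : R :=
  dot (tnth (Amat I) i) x - tnth (alpha I) i.

Definition violation x : R :=
  let i0 := lshift (kno I) (Ordinal (unk_gt0 I)) in
  \big[Num.max/slack x i0]_(i < unk I + kno I) slack x i.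

Definition well_separated (Delta : R) : Prop :=
  forall x, extreme_point (feasible I) x \/ extreme_point (domain I) x ->
    x <> xstar I ->
    (feasible I x /\ Delta <= gap x) \/
    (~ feasible I x /\ Delta <= violation x).

Definition efficacy_regret T (h : history R (dim I) (unk I) T) : R :=
  \sum_(t < T) Num.max (gap (tnth h t).1) 0.

Definition safety_violation T (h : history R (dim I) (unk I) T) : R :=
  \sum_(t < T) Num.max (violation (tnth h t).1) 0.

Definition feedback x (w : signal R (unk I)) : signal R (unk I) :=
  (dot (theta I) x + w.1,
   [tuple dot (tnth (A_unk I) i) x + tnth w.2 i | i < unk I]).

Definition record_round t
    (hxw : (history R (dim I) (unk I) t * action R (dim I)) *
           signal R (unk I)) :
    history R (dim I) (unk I) t.+1 :=
  [tuple of (hxw.1.2, feedback hxw.1.2 hxw.2) :: hxw.1.1].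

Lemma measurable_dot (a : (dim I).-tuple R) :
  measurable_fun [set: action R (dim I)] (dot a).
Proof.
by apply: measurable_sum => i; apply: measurable_funM => //; exact: measurable_tnth.
Qed.

Lemma measurable_record_round t : measurable_fun setT (@record_round t).
Proof.
have mx : measurable_fun setT
    (fun hxw : (history R (dim I) (unk I) t * action R (dim I)) *
      signal R (unk I) => hxw.1.2) by exact: measurableT_comp.
apply: measurable_cons; last exact: measurableT_comp.
apply: measurable_fun_pair => //; apply: measurable_fun_pair.
  apply: measurable_funD.
    by apply: (measurableT_comp (measurable_dot (theta I))).
  by apply: measurableT_comp.
apply/measurable_fun_tnthP => i.
rewrite (_ : _ \o _ = fun hxw =>
    dot (tnth (A_unk I) i) hxw.1.2 + tnth hxw.2.2 i); last first.
  by apply/funext => hxw /=; rewrite tnth_mktuple.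
apply: measurable_funD.
  by apply: (measurableT_comp (measurable_dot _)).
apply: (measurableT_comp (measurable_tnth i)).
by apply: measurableT_comp.
Qed.

Variable p : slb_policy I.

Definition round t : R.-pker history R (dim I) (unk I) t ~>
    history R (dim I) (unk I) t.+1 :=
  pkcomp (play p t) (pkcomp (noise I t) (kdirac (@measurable_record_round t))).

Lemma roundE t h C : measurable C ->
  (round t h C = \int[play p t h]_x
    noise I t (h, x) [set w | C (record_round ((h, x), w))])%E.
Proof.
move=> mC; rewrite /round /= /pkcomp /= /kcomp; apply: eq_integral => x _.
set D := [set w | _].
have mD : measurable D.
  have := measurable_record_round (t := t) measurableT mC.
  rewrite setTI => mRC; have := measurable_xsection (h, x) mRC.
  by rewrite xsectionE.
transitivity (\int[noise I t (h, x)]_w (\1_D w)%:E)%E; last first.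
  by rewrite integral_indic// setIT.
apply: eq_integral => w _.
by rewrite /= /kdirac diracE indicE /D; congr (_%:R%:E); apply/idP/idP; rewrite !inE.
Qed.

(* The law of the first T rounds when the policy p plays on the instance I. *)
Fixpoint interaction_law T : probability (history R (dim I) (unk I) T) R :=
  if T is t.+1 then pbind (interaction_law t) (round t) else \d_[tuple].

End instance.

(* Main.v *)
Require Import Defs.
From HB Require Import structures.
From mathcomp Require Import all_boot all_order all_algebra.
From mathcomp Require Import all_classical all_reals all_analysis.
From mathcomp Require Import measurable_realfun.
From mathcomp Require Import ring lra.
Import Order.TTheory GRing.Theory Num.Theory.
Import numFieldNormedType.Exports.
Local Open Scope classical_set_scope.
Local Open Scope ring_scope.
Set Implicit Arguments.
Unset Strict Implicit.
Unset Printing Implicit Defensive.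

(** On the segment [0, 1] with reward x and the single unknown constraint
    (1/4 + p/2) x <= 1/4, the optimum is u(p) = 1/(1 + 2p), and per round
    inefficiency plus violation is at least 3/8 |x - u(p)|.  The noise makes the
    feedback at x equal to x Z, where Z = 3/4 with probability p and 1/4
    otherwise, so for a given policy the parameter p enters only through T coin
    flips.  If |p - q| <= 1/(4 sqrt T), the likelihoods of p and q overlap by at
    least 1/2, hence the mean total distances to u(p) and u(q) add up to a
    constant times T |p - q|: parameters p with small regret at horizon T cluster
    within a fraction of 1/sqrt T.  A single p that is bad for the learner at all
    horizons is found by descending through nested windows for T = 16^k;
    monotonicity in T covers the other horizons. *)

(** * An exponential inequality behind the sub-Gaussian bound *)

(** Averaging over a centered variable removes the linear term and leaves only the exponential of a
    square. For [y <= -1/2] compare with [1]; for [|y| <= 1/2] use [expR y <= 1 / (1 - y)]; for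
    [y > 1/2] already [y <= 2 * y ^+ 2]. *)
Lemma expR_le_add_expR_sqr (R : realType) (y : R) :
  expR y <= y + expR (2 * y ^+ 2).
Proof.
have e0 := expR_ge1Dx (2 * y ^+ 2).
have [yl|yl] := leP y (- 2^-1).
  have : expR y <= 1 by rewrite -expR0 ler_expR; lra.
  nra.
have [yr|yr] := leP y 2^-1.
  have e1 := expR_ge1Dx (- y).
  have e2 : expR y * expR (- y) = 1 by rewrite -expRD subrr expR0.
  have e3 := expR_gt0 y.
  have : expR y * (1 - y) <= 1 by nra.
  have : 1 <= (1 + y + 2 * y ^+ 2) * (1 - y) by nra.
  nra.
have : expR y <= expR (2 * y ^+ 2) by rewrite ler_expR; nra.
lra.
Qed.

(** * Likelihoods of coin flips and the two-point bound *)

(** Sums over this list split on the first bit, which later stands for the most recent round, as in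
    histories. *)
Fixpoint bitseqs (n : nat) : seq bitseq :=
  if n is m.+1 then
    [seq true :: z | z <- bitseqs m] ++ [seq false :: z | z <- bitseqs m]
  else [:: [::]].

Lemma big_bitseqsS (T : Type) (idx : T) (op : Monoid.law idx) n
    (F : bitseq -> T) :
  \big[op/idx]_(z <- bitseqs n.+1) F z =
  op (\big[op/idx]_(z <- bitseqs n) F (true :: z))
     (\big[op/idx]_(z <- bitseqs n) F (false :: z)).
Proof. by rewrite big_cat !big_map. Qed.

Definition likelihood (R : realType) (p : R) (z : bitseq) : R :=
  \prod_(b <- z) bernoulli_pmf p b.

Lemma likelihood_cons (R : realType) (p : R) b z :
  likelihood p (b :: z) = bernoulli_pmf p b * likelihood p z.
Proof. by rewrite /likelihood big_cons. Qed.

Lemma likelihood_gt0 (R : realType) (p : R) z :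
  0 < p < 1 -> 0 < likelihood p z.
Proof.
move=> /andP[p0 p1]; apply: prodr_gt0 => -[] _ //=.
by rewrite /bernoulli_pmf subr_gt0.
Qed.

Lemma sum_likelihood (R : realType) (p : R) n :
  \sum_(z <- bitseqs n) likelihood p z = 1.
Proof.
elim: n => [|n IH]; first by rewrite /= big_seq1 /likelihood big_nil.
rewrite big_bitseqsS /=; under eq_bigr do rewrite likelihood_cons.
under [X in _ + X]eq_bigr do rewrite likelihood_cons.
by rewrite -!mulr_sumr IH /= /bernoulli_pmf !mulr1 subrKC.
Qed.

(** This is one plus the chi-square divergence, which is multiplicative over independent flips. *)
Lemma sum_sqr_likelihood (R : realType) (p q : R) n :
  \sum_(z <- bitseqs n) likelihood q z ^+ 2 / likelihood p z =
  (q ^+ 2 / p + (1 - q) ^+ 2 / (1 - p)) ^+ n.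
Proof.
elim: n => [|n IH].
  by rewrite /= big_seq1 /likelihood !big_nil divr1 expr1n expr0.
have E b z : likelihood q (b :: z) ^+ 2 / likelihood p (b :: z) =
    (bernoulli_pmf q b ^+ 2 / bernoulli_pmf p b) *
    (likelihood q z ^+ 2 / likelihood p z).
  by rewrite !likelihood_cons exprMn invfM mulrACA.
rewrite big_bitseqsS /=; under eq_bigr do rewrite E.
under [X in _ + X]eq_bigr do rewrite E.
by rewrite -!mulr_sumr IH -mulrDl /bernoulli_pmf /= -exprS.
Qed.

(** One flip contributes [1 + (q - p)^2 / (p (1 - p))], and [p (1 - p) >= 3/16], so the power is at
    most [expR (16/3 * n * (q - p)^2) <= expR (1/3) <= 3/2]. *)
Lemma chi_square_le2 (R : realType) (p q : R) n :
  4^-1 <= p <= 3 / 4 -> n%:R * (q - p) ^+ 2 <= 16^-1 ->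
  (q ^+ 2 / p + (1 - q) ^+ 2 / (1 - p)) ^+ n <= 2.
Proof.
move=> /andP[pl pr] npq.
have p0 : 0 < p by lra.
have p1 : 0 < 1 - p by lra.
set d := (q - p) ^+ 2.
have -> : q ^+ 2 / p + (1 - q) ^+ 2 / (1 - p) = 1 + d / (p * (1 - p)).
  by rewrite /d; field; rewrite !gt_eqF.
have d0 : 0 <= d by rewrite /d sqr_ge0.
have pp : 3 / 16 <= p * (1 - p) by nra.
have dle : d / (p * (1 - p)) <= 16 / 3 * d.
  rewrite ler_pdivrMr; last by nra.
  nra.
have dpos : 0 <= d / (p * (1 - p)) by apply: divr_ge0 => //; nra.
apply: (@le_trans _ _ (expR (16 / 3 * d) ^+ n)).
  apply: lerXn2r; rewrite ?nnegrE ?expR_ge0//; first by lra.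
  have := expR_ge1Dx (16 / 3 * d); lra.
rewrite -expRM_natl; apply: (@le_trans _ _ (expR 3^-1)).
  rewrite ler_expR; rewrite -/d in npq; move: npq; set m := n%:R.
  nra.
have e1 := expR_ge1Dx (- 3^-1 : R).
have e2 : expR (3^-1 : R) * expR (- 3^-1) = 1 by rewrite -expRD subrr expR0.
have e3 := expR_gt0 (3^-1 : R).
nra.
Qed.

Lemma likelihood_overlap (R : realType) (p q : R) n :
  4^-1 <= p <= 3 / 4 -> 4^-1 <= q <= 3 / 4 -> n%:R * (q - p) ^+ 2 <= 16^-1 ->
  2^-1 <= \sum_(z <- bitseqs n) Num.min (likelihood p z) (likelihood q z).
Proof.
move=> hp hq npq.
have p01 : 0 < p < 1 by lra.
have q01 : 0 < q < 1 by lra.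
(* With r the likelihood ratio, min(1, r) >= r - r^2 / 4; no square root is needed. *)
apply: (@le_trans _ _ (\sum_(z <- bitseqs n)
    (likelihood q z - 4^-1 * (likelihood q z ^+ 2 / likelihood p z)))).
  rewrite big_split /= sumrN -mulr_sumr sum_likelihood sum_sqr_likelihood.
  have := chi_square_le2 hp npq; lra.
apply: ler_sum => z _.
have := likelihood_gt0 z p01; have := likelihood_gt0 z q01.
set a := likelihood p z; set b := likelihood q z => b0 a0.
rewrite le_min; apply/andP; split; last first.
  by rewrite gerBl mulr_ge0// divr_ge0// ?sqr_ge0// ltW.
rewrite -(ler_pM2r a0) mulrBl -!mulrA mulVf ?gt_eqF// mulr1.
(* After multiplication by [a], the goal [b - b^2 / (4 a) <= a] says that this square is
   nonnegative. *)
have := sqr_ge0 (a - b / 2); rewrite !expr2; nra.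
Qed.

(** Le Cam's argument: replacing both likelihoods by their minimum leaves [G z + H z >= s] weighted
    by the overlap, which is at least one half. *)
Lemma two_point_le (R : realType) (p q : R) n (G H : bitseq -> \bar R) (s : R) :
  4^-1 <= p <= 3 / 4 -> 4^-1 <= q <= 3 / 4 -> n%:R * (q - p) ^+ 2 <= 16^-1 ->
  0 <= s -> (forall z, 0 <= G z)%E -> (forall z, 0 <= H z)%E ->
  (forall z, s%:E <= G z + H z)%E ->
  ((s / 2)%:E <= \sum_(z <- bitseqs n) (likelihood p z)%:E * G z +
                 \sum_(z <- bitseqs n) (likelihood q z)%:E * H z)%E.
Proof.
move=> hp hq npq s0 G0 H0 sGH.
have p01 : 0 < p < 1 by lra.
have q01 : 0 < q < 1 by lra.
rewrite -big_split /=.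
apply: (@le_trans _ _ (\sum_(z <- bitseqs n)
    (Num.min (likelihood p z) (likelihood q z) * s)%:E)%E).
  rewrite sumEFin lee_fin -mulr_suml mulrC ler_wpM2r//.
  exact: likelihood_overlap.
apply: lee_sum => z _.
have m0 : 0 <= Num.min (likelihood p z) (likelihood q z).
  by rewrite le_min !ltW// likelihood_gt0.
rewrite EFinM; apply: le_trans (lee_wpmul2l _ (sGH z)) _.
  by rewrite lee_fin.
rewrite ge0_muleDr//; apply: leeD; apply: lee_wpmul2r => //.
  by rewrite lee_fin ge_min lexx.
by rewrite lee_fin ge_min lexx orbT.
Qed.

(** * Nested windows avoiding a sequence of bad sets *)

(* Each bad set meets a window of its scale in a set of diameter less than half the
   window, so the left or the right quarter of the window avoids it; iterating
   on that quarter gives nested windows. *)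
Lemma nested_windows (R : realType) (bad : nat -> set R) (l0 D : R) :
  0 < D ->
  (forall k p q, l0 <= p -> q <= l0 + D ->
     D / 2 / 4 ^+ k <= q - p -> q - p <= D / 4 ^+ k -> bad k p -> bad k q -> False) ->
  exists2 p, l0 <= p <= l0 + D & forall k, ~ bad k p.
Proof.
move=> D0 sep.
pose w k := D / 4 ^+ k.
have wS k : w k.+1 = w k / 4 by rewrite /w exprS; field; rewrite expf_neq0.
have w0 k : 0 < w k by rewrite /w divr_gt0// exprn_gt0.
pose next k l := if `[< forall p, l <= p <= l + w k.+1 -> ~ bad k p >]
  then l else l + 3 * w k.+1.
pose l := nat_rect (fun _ => R) l0 next.
have lS k : l k.+1 = next k (l k) by [].
have mono k : l k <= l k.+1 /\ l k.+1 + w k.+1 <= l k + w k.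
  rewrite lS /next wS; have := w0 k.
  by case: ifP => _; split; lra.
have lub k : l0 <= l k /\ l k + w k <= l0 + D.
  elim: k => [|k [IH1 IH2]]; first by rewrite /w expr0 divr1 /=; split; lra.
  by have [? ?] := mono k; split; lra.
have lmono : {homo l : i j / (i <= j)%N >-> i <= j}.
  by apply: homo_leq => [//|? ? ?|k]; [exact: le_trans|have [] := mono k].
have rmono i j : (i <= j)%N -> l j + w j <= l i + w i.
  apply: (@homo_leq _ (fun k => l k + w k) (fun x y => y <= x)) => //.
    by move=> ? ? ? yx zy; exact: le_trans zy yx.
  by move=> k; have [] := mono k.
have lr i j : l i <= l j + w j.
  have [ij|ji] := leqP i j.
    by have := lmono _ _ ij; have := w0 j; lra.
  by have := rmono _ _ (ltnW ji); have := w0 i; lra.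
have good k p : l k.+1 <= p <= l k.+1 + w k.+1 -> ~ bad k p.
  rewrite lS /next; case: ifPn => [/asboolP|/asboolPn]; first exact.
  move=> /existsNP[q] /not_implyP[hq /contrapT bq] hp bp.
  (* A bad [q] in the left quarter and a bad [p] in the right one lie between [w k / 2] and [w k]
     apart, which [sep] forbids. *)
  have [? ?] := lub k; have := w0 k; have := wS k => wS' w0'.
  have [] : D / 2 / 4 ^+ k <= p - q /\ p - q <= D / 4 ^+ k.
    rewrite mulrAC -/(w k); split; lra.
  by move=> h1 h2; apply: (sep k q p) => //; lra.
(* By [lr] every left end is below every right end, so the supremum of the left ends lies in all the
   windows. *)
exists (sup (range l)).
  apply/andP; split.
    apply: ub_le_sup; last by exists 0%N.
    by exists (l0 + D) => _ [k _ <-]; have := lub k; have := w0 k; lra.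
  apply: sup_le_ub; first by exists l0, 0%N.
  by move=> _ [k _ <-]; have := lub k; have := w0 k; lra.
move=> k; apply: good; apply/andP; split.
  apply: ub_le_sup; last by exists k.+1.
  by exists (l0 + D) => _ [j _ <-]; have := lub j; have := w0 j; lra.
apply: sup_le_ub; first by exists l0, 0%N.
by move=> _ [j _ <-]; exact: lr.
Qed.

(** * Integration against composed kernels *)

Section kernel_integrals.
Context d1 d2 d3 (X : measurableType d1) (Y : measurableType d2)
  (Z : measurableType d3) (R : realType).
Local Open Scope ereal_scope.

Lemma integral_pkcomp (l : R.-pker X ~> Y) (k : R.-pker (X * Y) ~> Z) x
    (f : Z -> \bar R) :
  (forall z, 0 <= f z) -> measurable_fun setT f ->
  \int[pkcomp l k x]_z f z = \int[l x]_y \int[k (x, y)]_z f z.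
Proof. by move=> f0 mf; rewrite -integral_kcomp. Qed.

Lemma integral_kdirac (g : X -> Y) (mg : measurable_fun setT g) x
    (f : Y -> \bar R) : measurable_fun setT f ->
  \int[kdirac mg x]_y f y = f (g x).
Proof. by move=> mf; rewrite integral_dirac// diracT mul1e. Qed.

Lemma integral_pbind (P : probability X R) (k : R.-pker X ~> Y)
    (f : Y -> \bar R) :
  (forall y, 0 <= f y) -> measurable_fun setT f ->
  \int[pbind P k]_y f y = \int[P]_x \int[k x]_y f y.
Proof.
move=> f0 mf.
(* [P] is viewed as a constant kernel on the one-point space, which turns [pbind P k] into a
   composition of kernels. *)
have mP : measurable_fun [set: unit] (fun=> P : pprobability X R).
  exact: measurable_cst.
transitivity (\int[kcomp (kprobability mP) (kernel.kernel_snd k) tt]_y f y).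
  exact: eq_measure_integral.
by rewrite integral_kcomp.
Qed.

End kernel_integrals.

(** * Vectors of dimension one and extreme points of a segment *)

Section one_dimension.
Context {R : realType}.
Implicit Types x y : 1.-tuple R.

Lemma dot1E x y : dot x y = tnth x ord0 * tnth y ord0.
Proof. by rewrite /dot big_ord1. Qed.

Lemma tuple1_inj x y : tnth x ord0 = tnth y ord0 -> x = y.
Proof. by move=> xy; apply: eq_from_tnth => i; rewrite ord1. Qed.

Lemma norm2_tuple1 (r : R) : norm2 [tuple r] = `|r|.
Proof. by rewrite /norm2 dot1E (tnth_nth 0)/= -expr2 sqrtr_sqr. Qed.

(** A point strictly between [lo] and [hi] is their convex combination with weight [l], so
    extremality would make it equal to [lo]. *)
Lemma extreme_point_segment (C : set (1.-tuple R)) (lo hi : R) x :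
  (forall y, C y <-> lo <= tnth y ord0 <= hi) -> extreme_point C x ->
  tnth x ord0 = lo \/ tnth x ord0 = hi.
Proof.
move=> CE [Cx ext]; have /CE /andP[lox xhi] := Cx.
have [->|xlo] := eqVneq (tnth x ord0) lo; first by left.
have [->|xh] := eqVneq (tnth x ord0) hi; first by right.
have {}lox : lo < tnth x ord0 by rewrite lt_neqAle eq_sym xlo.
have {}xhi : tnth x ord0 < hi by rewrite lt_neqAle xh.
have lohi : 0 < hi - lo by lra.
pose l := (hi - tnth x ord0) / (hi - lo).
have l01 : 0 < l < 1.
  by rewrite /l; apply/andP; split; [apply: divr_gt0|rewrite ltr_pdivrMr//]; lra.
have [] := ext l [tuple lo] [tuple hi] l01.
- by apply/CE; rewrite (tnth_nth 0)/=; lra.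
- by apply/CE; rewrite (tnth_nth 0)/=; lra.
- apply: tuple1_inj; rewrite tnth_mktuple /l !(tnth_nth 0)/=.
  by field; rewrite gt_eqF// -(tnth_nth 0).
by move=> /(congr1 (fun y => tnth y ord0)); rewrite (tnth_nth 0)/=; lra.
Qed.

End one_dimension.

(** * The family of hard instances on the unit segment *)

Section hard_instance.
Variable R : realType.

Definition unit_rows : 2.-tuple (1.-tuple R) := [tuple [tuple 1]; [tuple -1]].
Definition unit_bounds : 2.-tuple R := [tuple 1; 0].

Lemma unit_polyhedronE (x : 1.-tuple R) :
  polyhedron unit_rows unit_bounds x <-> 0 <= tnth x ord0 <= 1.
Proof.
split=> [h|/andP[x0 x1]].
  have := h ord0; have := h ord_max.
  rewrite !dot1E !(tnth_nth 0) /=. lra.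
by case=> -[|[|//]] ?; rewrite dot1E !(tnth_nth 0)/=;
  move: x0 x1; rewrite !(tnth_nth 0) /=; lra.
Qed.

Lemma unit_ball : polyhedron unit_rows unit_bounds `<=` [set x | norm2 x <= 1].
Proof.
move=> x /unit_polyhedronE /andP[x0 x1] /=.
by rewrite /norm2 dot1E -expr2 sqrtr_sqr ger0_norm.
Qed.

Lemma unit_neq0 : polyhedron unit_rows unit_bounds !=set0.
Proof. by exists [tuple 0]; apply/unit_polyhedronE; rewrite lexx ler01. Qed.

(** These data do not involve [p], so an algorithm commits to a single policy for the whole
    family. *)
Definition hard_known : slb_known R :=
  @SLBKnown R 1 1 2 isT isT unit_rows unit_bounds [tuple 4^-1]
    unit_ball unit_neq0.

Definition bit (b : bool) : R := if b then 3 / 4 else 4^-1.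

(* The mean of [bit b] when [b] is Bernoulli of parameter [p]. *)
Definition slope (p : R) : R := 4^-1 + p / 2.
Definition optimum (p : R) : R := (1 + 2 * p)^-1.

(** * The noise law and its moment conditions *)

Section noise.
Variables (p : R) (t : nat).
Let Y := (history R 1 1 t * action R 1)%type.

(** The reward carries no noise. The constraint noise is scaled by the action so that it turns the
    mean [slope p * x] into [x * bit b]. *)
Definition noise_map (hxb : Y * bool) : signal R 1 :=
  (0, [tuple tnth hxb.1.2 ord0 * (bit hxb.2 - slope p)]).

Lemma measurable_noise_map : measurable_fun setT noise_map.
Proof.
apply: measurable_fun_pair; first exact: measurable_cst.
apply/measurable_fun_tnthP => i; rewrite (ord1 i).
apply: (@measurable_funM _ _ _ _ (fun hxb : Y * bool => tnth hxb.1.2 ord0)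
   (fun hxb => bit hxb.2 - slope p)).
  apply: (measurableT_comp (measurable_tnth ord0)).
  by apply: measurableT_comp.
apply: measurable_funB; last exact: measurable_cst.
by apply: measurableT_comp.
Qed.

Let mP : measurable_fun [set: Y] (fun=> bernoulli_prob p : pprobability bool R).
Proof. exact: measurable_cst. Qed.

Definition hard_noise : R.-pker Y ~> signal R 1 :=
  pkcomp (kprobability mP) (kdirac measurable_noise_map).

Lemma integral_hard_noise hx (f : signal R 1 -> \bar R) : 0 <= p <= 1 ->
  (forall w, 0 <= f w)%E -> measurable_fun setT f ->
  (\int[hard_noise hx]_w f w =
   p%:E * f (noise_map (hx, true)) + (1 - p)%:E * f (noise_map (hx, false)))%E.
Proof.
move=> p01 f0 mf; rewrite /hard_noise integral_pkcomp//.
under eq_integral do rewrite integral_kdirac//.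
by rewrite integral_bernoulli_prob.
Qed.

(** Splitting into positive and negative parts extends the two-point formula to signed integrands,
    as centering requires. *)
Lemma integral_hard_noise_EFin hx (f : signal R 1 -> R) : 0 <= p <= 1 ->
  measurable_fun setT f ->
  (\int[hard_noise hx]_w (f w)%:E =
   (p * f (noise_map (hx, true)) + (1 - p) * f (noise_map (hx, false)))%:E)%E.
Proof.
move=> p01 mf; have mEf : measurable_fun setT (EFin \o f) by exact/measurable_EFinP.
rewrite integralE !integral_hard_noise//; last 2 first.
  exact: measurable_funeneg.
  exact: measurable_funepos.
have fE w : ((EFin \o f)^\+ w = (Num.max (f w) 0)%:E)%E by rewrite funeposE EFin_max.
have gE w : ((EFin \o f)^\- w = (Num.max (- f w) 0)%:E)%E by rewrite funenegE EFin_max.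
have maxE (r : R) : r = Num.max r 0 - Num.max (- r) 0.
  by rewrite !maxEle; case: (leP r 0); case: (leP (- r) 0); lra.
rewrite !fE !gE -!EFinM -!EFinD; congr EFin.
rewrite [f (noise_map (hx, true)) in RHS]maxE [f (noise_map (hx, false)) in RHS]maxE.
ring.
Qed.

Lemma hard_noise_centered hx : 0 <= p <= 1 -> centered (hard_noise hx).
Proof.
move=> p01; split=> [|i].
  rewrite integral_hard_noise_EFin//.
  by rewrite /= !mulr0 addr0.
rewrite (ord1 i) integral_hard_noise_EFin//; last first.
  by apply: (measurableT_comp (measurable_tnth ord0)).
by rewrite /= !(tnth_nth 0) /= /slope /bit; congr EFin; field.
Qed.

(** With [v = y * x * (bit b - slope p)], use [expR v <= v + expR (2 * v ^+ 2)]. The mean of [v] is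
    zero, and [2 * v ^+ 2 <= y ^+ 2 / 2] because [|x| <= 1] and [|bit b - slope p| <= 1/2]. *)
Lemma hard_noise_sub_gaussian hx : 0 <= p <= 1 -> `|tnth hx.2 ord0| <= 1 ->
  sub_gaussian (hard_noise hx).
Proof.
move=> p01 x1 [l1 l2]; rewrite integral_hard_noise_EFin//; last first.
  apply: measurableT_comp => //; apply: measurable_funD.
    by apply: measurable_funM.
  rewrite /dot; apply: measurable_sum => i; apply: measurable_funM => //.
  by apply: (measurableT_comp (measurable_tnth i)).
rewrite lee_fin !dot1E /= mulr0 !add0r.
rewrite ![tnth [tuple _] _](tnth_nth 0)/=.
set x := tnth hx.2 ord0 in x1 *; set y := tnth l2 ord0.
have [p0 p1] := andP p01.
have E1 := expR_le_add_expR_sqr (y * (x * (bit true - slope p))).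
have E2 := expR_le_add_expR_sqr (y * (x * (bit false - slope p))).
have xx : x ^+ 2 <= 1 by move: x1; rewrite ler_norml => /andP[? ?]; nra.
have F (u : R) : u ^+ 2 <= 4^-1 ->
    expR (2 * (y * (x * u)) ^+ 2) <= expR ((l1 ^+ 2 + y * y) / 2).
  move=> u4; rewrite ler_expR !exprMn.
  have := sqr_ge0 l1; have := sqr_ge0 y; have := sqr_ge0 x; have := sqr_ge0 u.
  rewrite -expr2.
  set Y2 := y ^+ 2; set X2 := x ^+ 2 in xx *; set U2 := u ^+ 2 in u4 *; set L2 := l1 ^+ 2.
  move=> U0 X0 Y0 L0.
  have : X2 * U2 <= 4^-1 by nra.
  nra.
have F1 := F (bit true - slope p); have F2 := F (bit false - slope p).
have {}F1 : expR (2 * (y * (x * (bit true - slope p))) ^+ 2) <=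
    expR ((l1 ^+ 2 + y * y) / 2) by apply: F1; rewrite /bit /slope; nra.
have {}F2 : expR (2 * (y * (x * (bit false - slope p))) ^+ 2) <=
    expR ((l1 ^+ 2 + y * y) / 2) by apply: F2; rewrite /bit /slope; nra.
move: F1 F2 E1 E2.
set e1 := expR (y * (x * (bit true - slope p))).
set e2 := expR (y * (x * (bit false - slope p))).
set g1 := expR (2 * _); set g2 := expR (2 * _); set g := expR (_ / 2).
move=> F1 F2 E1 E2.
have H1 : p * e1 <= p * (y * (x * (bit true - slope p)) + g).
  by apply: ler_wpM2l => //; lra.
have H2 : (1 - p) * e2 <= (1 - p) * (y * (x * (bit false - slope p)) + g).
  by apply: ler_wpM2l => //; lra.
apply: le_trans (lerD H1 H2) _.
by rewrite le_eqVlt; apply/orP; left; apply/eqP; rewrite /bit /slope; field.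
Qed.

End noise.

(** * The instance at a fixed parameter and its separation *)

Section hard_instance_at.
Variable p : R.
Hypothesis p_mid : 4^-1 <= p <= 3 / 4.

Let p01 : 0 <= p <= 1. Proof. by have := p_mid; lra. Qed.

Let A_unk : 1.-tuple (1.-tuple R) := [tuple [tuple slope p]].

Lemma slope_optimum : slope p * optimum p = 4^-1.
Proof.
have [? ?] := andP p_mid; rewrite /slope /optimum; field.
by rewrite gt_eqF//; lra.
Qed.

Lemma optimum_bounds : 2 / 5 <= optimum p <= 2 / 3.
Proof.
have [? ?] := andP p_mid.
by rewrite /optimum; apply/andP; split; rewrite -invf_div lef_pV2 ?posrE; lra.
Qed.

Lemma hard_polyhedronE (x : 1.-tuple R) :
  polyhedron [tuple of A_unk ++ unit_rows] (alpha hard_known) x <->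
  0 <= tnth x ord0 <= optimum p.
Proof.
have [p0 p1] := andP p_mid; have [ol oh] := andP optimum_bounds.
have so := slope_optimum; have s0 : 0 < slope p by rewrite /slope; lra.
split=> [h|/andP[x0 x1]].
  have := h ord0; have := h ord_max.
  rewrite !dot1E !(tnth_nth 0) /= -so ler_pM2l//; lra.
case=> -[|[|[|//]]] ?; rewrite dot1E !(tnth_nth 0)/=; move: x0 x1;
  rewrite !(tnth_nth 0) /= => x0 x1; try lra.
by rewrite -so ler_pM2l.
Qed.

Let theta_le1 : norm2 [tuple 1 : R] <= 1.
Proof. by rewrite norm2_tuple1 normr1. Qed.

Let Amat_le1 (i : 'I_3) : norm2 (tnth [tuple of A_unk ++ unit_rows] i) <= 1.
Proof.
have [? ?] := andP p_mid.
case: i => -[|[|[|//]]] ?; rewrite (tnth_nth [tuple 0])/= norm2_tuple1.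
- by rewrite ger0_norm /slope; lra.
- by rewrite normr1.
- by rewrite normrN1.
Qed.

Let xstar_feasible :
  polyhedron [tuple of A_unk ++ unit_rows] (alpha hard_known) [tuple optimum p].
Proof.
have [? ?] := andP optimum_bounds.
by apply/hard_polyhedronE; rewrite (tnth_nth 0)/=; lra.
Qed.

Let xstar_max x :
  polyhedron [tuple of A_unk ++ unit_rows] (alpha hard_known) x ->
  dot [tuple 1] x <= dot [tuple 1] [tuple optimum p].
Proof.
move=> /hard_polyhedronE /andP[_]; rewrite !dot1E.
by rewrite ![tnth [tuple _] _](tnth_nth 0)/= !mul1r.
Qed.

Let noise_centered t h x : domain hard_known x -> centered (hard_noise p t (h, x)).
Proof. by move=> _; exact: hard_noise_centered. Qed.

Let noise_sub_gaussian t h x : domain hard_known x ->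
  sub_gaussian (hard_noise p t (h, x)).
Proof.
move=> /unit_polyhedronE/andP[x0 x1]; apply: hard_noise_sub_gaussian => //=.
by rewrite ger0_norm.
Qed.

Definition hard_slb : slb_instance R :=
  @SLBInstance R hard_known [tuple 1] A_unk [tuple optimum p] (hard_noise p)
    theta_le1 Amat_le1 xstar_feasible xstar_max noise_centered noise_sub_gaussian.

Lemma gap_hard x : gap (I := hard_slb) x = optimum p - tnth x ord0.
Proof. by rewrite /gap !dot1E /= ![tnth [tuple _] _](tnth_nth 0)/= !mul1r. Qed.

Lemma violation_hard_ge x :
  slope p * (tnth x ord0 - optimum p) <= violation (I := hard_slb) x.
Proof.
apply: (@le_trans _ _ (slack (I := hard_slb) x ord0)).
  rewrite /slack dot1E mulrBr slope_optimum.
  by rewrite !(tnth_nth 0).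
exact: (le_bigmax _ _ ord0).
Qed.

(** The extreme points lie among [0], [optimum p] and [1]. At [0] the gap is [optimum p >= 2/5]; at
    [1] the violation is at least [slope p - 1/4 = p / 2], which is where [p >= 1/4] gives [1/8]. *)
Lemma hard_slb_well_separated : well_separated hard_slb (1 / 8).
Proof.
have [p0 p1] := andP p_mid; have [ol oh] := andP optimum_bounds.
have sep0 x : tnth x ord0 = 0 -> feasible hard_slb x /\ 1 / 8 <= gap (I := hard_slb) x.
  move=> x0; split; first by apply/hard_polyhedronE; rewrite x0; lra.
  by rewrite gap_hard x0; lra.
move=> x [] ex xs.
  have [x0|x0] := extreme_point_segment hard_polyhedronE ex.
    by left; exact: sep0.
  by exfalso; apply: xs; apply: tuple1_inj; rewrite x0 (tnth_nth 0).
have [x0|x1] := extreme_point_segment unit_polyhedronE ex.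
  by left; exact: sep0.
right; split.
  by move=> /hard_polyhedronE; rewrite x1; lra.
apply: le_trans (violation_hard_ge x); rewrite x1 mulrBr slope_optimum /slope.
lra.
Qed.

End hard_instance_at.

End hard_instance.

(** * The interaction as a mixture over coin flips *)

Lemma integral_interaction_lawS (R : realType) (I : slb_instance R)
    (pol : slb_policy I) T (F : history R (Defs.dim I) (unk I) T.+1 -> \bar R) :
  (forall h, 0 <= F h)%E -> measurable_fun setT F ->
  (\int[interaction_law pol T.+1]_h F h =
   \int[interaction_law pol T]_h \int[round pol T h]_h' F h')%E.
Proof. exact: integral_pbind. Qed.

Section driven_by_bits.
Variables (R : realType) (pol : slb_policy (hard_known R)).

Definition extend t (b : bool) (hx : history R 1 1 t * action R 1) :
    history R 1 1 t.+1 :=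
  [tuple of (hx.2, (tnth hx.2 ord0, [tuple tnth hx.2 ord0 * bit R b])) :: hx.1].

Lemma measurable_extend t b : measurable_fun setT (@extend t b).
Proof.
have mx : measurable_fun setT
    (fun hx : history R 1 1 t * action R 1 => tnth hx.2 ord0).
  by apply: (measurableT_comp (measurable_tnth ord0)).
apply: measurable_cons => //; apply: measurable_fun_pair => //.
apply: measurable_fun_pair => //; apply/measurable_fun_tnthP => i.
rewrite (ord1 i); apply: (measurable_funM mx); exact: measurable_cst.
Qed.

(** Backward operator of one round with the flip held fixed: only the randomisation of the learner
    is averaged. *)
Definition step t b (F : history R 1 1 t.+1 -> \bar R) (h : history R 1 1 t) :=
  (\int[play pol t h]_x F (extend b (h, x)))%E.

(** Expectation of [F] given the flips [z], free of [p]. The head of [z] drives the last round; the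
    default [false] is never reached for [z] in [bitseqs t]. *)
Fixpoint play_bits t (z : bitseq) : (history R 1 1 t -> \bar R) -> \bar R :=
  match t return (history R 1 1 t -> \bar R) -> \bar R with
  | 0%N => fun F => F [tuple]
  | t'.+1 => fun F => play_bits (behead z) (step (head false z) F)
  end.

Section step_theory.
Variables (t : nat) (b : bool).
Local Open Scope ereal_scope.
Implicit Types F G : history R 1 1 t.+1 -> \bar R.

Lemma measurable_step F : (forall h, 0 <= F h) -> measurable_fun setT F ->
  measurable_fun setT (step b F).
Proof.
move=> F0 mF; apply: (@measurable_fun_integral_sfinite_kernel _ _ _ _ _
  (fun hx => F (extend b hx)) (play pol t)) => //.
by apply: measurableT_comp => //; exact: measurable_extend.
Qed.

Lemma measurable_extend_action h F : measurable_fun setT F ->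
  measurable_fun setT (fun x => F (extend b (h, x))).
Proof.
move=> mF; apply: (measurableT_comp mF).
by apply: (measurableT_comp (@measurable_extend t b)).
Qed.

Lemma step_ge0 F h : (forall h, 0 <= F h) -> 0 <= step b F h.
Proof. by move=> F0; exact: integral_ge0. Qed.

Lemma step_linear (c c' : R) F G h : (0 <= c)%R -> (0 <= c')%R ->
  (forall h, 0 <= F h) -> measurable_fun setT F ->
  (forall h, 0 <= G h) -> measurable_fun setT G ->
  step b (fun h => c%:E * F h + c'%:E * G h) h =
  c%:E * step b F h + c'%:E * step b G h.
Proof.
move=> c0 c'0 F0 mF G0 mG; rewrite /step ge0_integralD//.
- rewrite !ge0_integralZl//; exact: measurable_extend_action.
- by move=> x _; rewrite mule_ge0.
- by apply: measurable_funeM; exact: measurable_extend_action.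
- by move=> x _; rewrite mule_ge0.
- by apply: measurable_funeM; exact: measurable_extend_action.
Qed.

Lemma step_ge (s : \bar R) F h : 0 <= s -> measurable_fun setT F ->
  (forall x, s <= F (extend b (h, x))) -> s <= step b F h.
Proof.
move=> s0 mF sF; apply: (@le_trans _ _ (\int[play pol t h]_x s)).
  by rewrite integral_cst// prob_kernel mule1.
by apply: ge0_le_integral => //; exact: measurable_extend_action.
Qed.

End step_theory.

Lemma play_bits_ge0 t z (F : history R 1 1 t -> \bar R) :
  (forall h, 0 <= F h)%E -> (0 <= play_bits z F)%E.
Proof. by elim: t z F => [|t IH] z F F0 //=; apply: IH => h; exact: step_ge0. Qed.

Lemma play_bits_linear t z (c c' : R) (F G : history R 1 1 t -> \bar R) :
  0 <= c -> 0 <= c' ->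
  (forall h, 0 <= F h)%E -> measurable_fun setT F ->
  (forall h, 0 <= G h)%E -> measurable_fun setT G ->
  (play_bits z (fun h => c%:E * F h + c'%:E * G h) =
   c%:E * play_bits z F + c'%:E * play_bits z G)%E.
Proof.
move=> c0 c'0; elim: t z F G => [|t IH] z F G F0 mF G0 mG /=; first by [].
rewrite -IH//; [|by move=> h; exact: step_ge0|exact: measurable_step|
  by move=> h; exact: step_ge0|exact: measurable_step].
by congr play_bits; apply/funext => h; exact: step_linear.
Qed.

Lemma play_bits_ge t z (s : \bar R) (F : history R 1 1 t -> \bar R) :
  (0 <= s)%E -> measurable_fun setT F -> (forall h, s <= F h)%E ->
  (s <= play_bits z F)%E.
Proof.
move=> s0; elim: t z F => [|t IH] z F mF sF /=; first exact: sF.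
apply: IH => [|h]; last exact: step_ge.
by apply: measurable_step => // h; exact: le_trans s0 (sF h).
Qed.

Section at_parameter.
Variables (p : R) (p_mid : 4^-1 <= p <= 3 / 4).
Let I := hard_slb p_mid.
Let p01 : 0 <= p <= 1. Proof. by have := p_mid; lra. Qed.
Let p_ge0 : 0 <= p. Proof. by have := p_mid; lra. Qed.
Let q_ge0 : 0 <= 1 - p. Proof. by have := p_mid; lra. Qed.

(* The slope cancels in the feedback: it enters only through the law of the bits. *)
Lemma record_roundE t (hx : history R 1 1 t * action R 1) b :
  record_round (I := I) (hx, noise_map p (hx, b)) = extend b hx.
Proof.
rewrite /record_round /extend /feedback /= dot1E addr0; apply: val_inj => /=.
congr ((_, (_, _)) :: _); first by rewrite (tnth_nth 0)/= mul1r.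
apply: tuple1_inj; rewrite !tnth_mktuple dot1E ![tnth [tuple _] _](tnth_nth 0)/=.
by rewrite (tnth_nth 0)/= -/(slope p); ring.
Qed.

(** The law of the flip does not depend on the action, so the average over the flip can be moved
    outside that over the action. *)
Lemma integral_round t h (F : history R 1 1 t.+1 -> \bar R) :
  (forall h, 0 <= F h)%E -> measurable_fun setT F ->
  (\int[round (I := I) pol t h]_h' F h' =
   p%:E * step true F h + (1 - p)%:E * step false F h)%E.
Proof.
move=> F0 mF; rewrite /round integral_pkcomp//.
rewrite -ge0_integralZl//; [|exact: measurable_extend_action].
rewrite -ge0_integralZl//; [|exact: measurable_extend_action].
rewrite -ge0_integralD//; [|by move=> x _; rewrite mule_ge0|
  by apply: measurable_funeM; exact: measurable_extend_action|
  by move=> x _; rewrite mule_ge0|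
  by apply: measurable_funeM; exact: measurable_extend_action].
apply: eq_integral => x _; rewrite integral_pkcomp//.
have mrec := measurable_record_round (I := I) (t := t).
under eq_integral do rewrite integral_kdirac//.
rewrite (@integral_hard_noise _ p t (h, x)
  (fun w => F (record_round (I := I) ((h, x), w))))//.
  by rewrite !record_roundE.
apply: (measurableT_comp mF); apply: (measurableT_comp mrec).
by apply: measurable_fun_pair.
Qed.

(** The likelihoods carry all the dependence of the law on [p]. The induction peels off the last
    round, that is, the first bit. *)
Lemma integral_interaction_law T (F : history R 1 1 T -> \bar R) :
  (forall h, 0 <= F h)%E -> measurable_fun setT F ->
  (\int[interaction_law (I := I) pol T]_h F h =
   \sum_(z <- bitseqs T) (likelihood p z)%:E * play_bits z F)%E.
Proof.
elim: T F => [|T IH] F F0 mF.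
  by rewrite integral_dirac// diracT mul1e /= big_seq1 /likelihood big_nil mul1e.
rewrite integral_interaction_lawS//.
under eq_integral do rewrite integral_round//.
have m b : measurable_fun setT (step b F) by exact: measurable_step.
have s0 b h : (0 <= step b F h)%E by exact: step_ge0.
rewrite IH; first last.
- by apply: emeasurable_funD; apply: measurable_funeM.
- by move=> h; rewrite adde_ge0// mule_ge0.
rewrite big_bitseqsS /= -big_split /=; apply: eq_bigr => z _.
rewrite play_bits_linear// !likelihood_cons /bernoulli_pmf /=.
have l0 : 0 <= likelihood p z.
  by rewrite ltW// likelihood_gt0//; have := p_mid; lra.
rewrite ge0_muleDr ?mule_ge0 ?play_bits_ge0 ?lee_fin//.
by rewrite !EFinM -!muleA; congr (_ + _)%E; exact: muleCA.
Qed.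

End at_parameter.

End driven_by_bits.

(** * Measurability of the two metrics *)

Section measurable_regret.
Context {R : realType} (I : slb_instance R).

Lemma measurable_bigmax d (T : measurableType d) (J : Type) (s : seq J)
    (f0 : T -> R) (f : J -> T -> R) :
  measurable_fun setT f0 -> (forall j, measurable_fun setT (f j)) ->
  measurable_fun setT (fun x => \big[Num.max/f0 x]_(j <- s) f j x).
Proof.
move=> mf0 mf; elim: s => [|j s IH]; first by under eq_fun do rewrite big_nil.
by under eq_fun do rewrite big_cons; apply: measurable_maxr.
Qed.

Lemma measurable_round_cost T (c : action R (Defs.dim I) -> R) :
  measurable_fun setT c ->
  measurable_fun setT (fun h : history R (Defs.dim I) (unk I) T =>
    \sum_(t < T) c (tnth h t).1).
Proof.
move=> mc; apply: measurable_sum => t; apply: (measurableT_comp mc).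
by apply: (measurableT_comp measurable_fst); exact: measurable_tnth.
Qed.

Lemma measurable_efficacy_regret T :
  measurable_fun setT (@efficacy_regret R I T).
Proof.
apply: (measurable_round_cost (c := fun x => Num.max (gap x) 0)).
apply: measurable_maxr; last exact: measurable_cst.
by apply: measurable_funB; [exact: measurable_cst|exact: measurable_dot].
Qed.

Lemma measurable_safety_violation T :
  measurable_fun setT (@safety_violation R I T).
Proof.
apply: (measurable_round_cost (c := fun x => Num.max (violation x) 0)).
apply: measurable_maxr; last exact: measurable_cst.
have ms i : measurable_fun setT (fun x : action R (Defs.dim I) => slack x i).
  by apply: measurable_funB; [exact: measurable_dot|exact: measurable_cst].
exact: measurable_bigmax.
Qed.

End measurable_regret.

(** * Total distance to the optimum and the choice of the parameter *)

Section distance_to_optimum.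
Variables (R : realType) (pol : slb_policy (hard_known R)).

(** A surrogate for the sum of both metrics that treats undershoot and overshoot alike, so that the
    triangle inequality compares two optima. *)
Definition distance (u : R) T (h : history R 1 1 T) : R :=
  \sum_(t < T) `|tnth (tnth h t).1 ord0 - u|.

Lemma distance_ge0 u T (h : history R 1 1 T) : 0 <= distance u h.
Proof. exact: sumr_ge0. Qed.

Lemma measurable_distance u T :
  measurable_fun setT (fun h : history R 1 1 T => (distance u h)%:E).
Proof.
apply/measurable_EFinP; apply: measurable_sum => t.
apply: measurableT_comp => //; apply: measurable_funB => //.
apply: (measurableT_comp (measurable_tnth ord0)).
by apply: (measurableT_comp measurable_fst); exact: measurable_tnth.
Qed.

Lemma distance_extend u T b (hx : history R 1 1 T * action R 1) :
  distance u hx.1 <= distance u (extend b hx).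
Proof.
rewrite /distance [leRHS]big_ord_recl; apply: ler_wpDl => //.
by apply: ler_sum => t _; rewrite tnthS.
Qed.

Lemma distanceD_ge u v T (h : history R 1 1 T) :
  T%:R * `|u - v| <= distance u h + distance v h.
Proof.
rewrite /distance -big_split /= mulr_natl -[T in _ *+ T]card_ord -sumr_const.
apply: ler_sum => t _; set x := tnth _ ord0.
by rewrite (distrC x u); exact: ler_distD.
Qed.

Definition mean_distance p (hp : 4^-1 <= p <= 3 / 4) T : \bar R :=
  (\int[interaction_law (I := hard_slb hp) pol T]_h (distance (optimum p) h)%:E)%E.

Lemma mean_distanceE p (hp : 4^-1 <= p <= 3 / 4) T :
  mean_distance hp T = (\sum_(z <- bitseqs T) (likelihood p z)%:E *
    play_bits pol z (fun h : history R 1 1 T => (distance (optimum p) h)%:E))%E.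
Proof.
apply: integral_interaction_law; last exact: measurable_distance.
by move=> h; rewrite lee_fin distance_ge0.
Qed.

(** A further round adds a nonnegative term. This carries bounds at the horizons [16 ^ k] over to
    all later ones. *)
Lemma mean_distanceS p (hp : 4^-1 <= p <= 3 / 4) T :
  (mean_distance hp T <= mean_distance hp T.+1)%E.
Proof.
have mD n := @measurable_distance (optimum p) n.
have D0 n (h : history R 1 1 n) : (0 <= (distance (optimum p) h)%:E)%E.
  by rewrite lee_fin distance_ge0.
rewrite /mean_distance integral_interaction_lawS//.
apply: ge0_le_integral => //.
  exact: mD.
  apply: measurable_fun_integral_kernel; last exact: mD.
    by move=> U mU; exact: measurable_kernel.
  exact: D0.
move=> h _; rewrite integral_round//.
have [p0 p1] := andP hp.
apply: (@le_trans _ _ (p%:E * (distance (optimum p) h)%:E +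
    (1 - p)%:E * (distance (optimum p) h)%:E)%E).
  by rewrite -!EFinM -EFinD lee_fin; lra.
have ge b : ((distance (optimum p) h)%:E <=
    step pol b (fun h' => (distance (optimum p) h')%:E) h)%E.
  apply: step_ge => // x; rewrite lee_fin.
  exact: (distance_extend _ _ (h, x)).
by apply: leeD; apply: lee_wpmul2l; rewrite ?lee_fin//; lra.
Qed.

Lemma mean_distance_le p (hp : 4^-1 <= p <= 3 / 4) :
  {homo mean_distance hp : m n / (m <= n)%N >-> (m <= n)%E}.
Proof.
by apply: homo_leq => [//|? ? ?|n]; [exact: le_trans|exact: mean_distanceS].
Qed.

(** Given the flips, the policy produces the same law of histories under [p] and [q], and on each
    history the two distances add up to at least [T] times the distance of the optima; the overlap
    of the likelihoods keeps half of this. *)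
Lemma mean_distance_two_point p q (hp : 4^-1 <= p <= 3 / 4)
    (hq : 4^-1 <= q <= 3 / 4) T :
  T%:R * (q - p) ^+ 2 <= 16^-1 ->
  ((T%:R * `|optimum p - optimum q| / 2)%:E <=
   mean_distance hp T + mean_distance hq T)%E.
Proof.
move=> npq.
have mD u := @measurable_distance u T.
have D0 u (h : history R 1 1 T) : (0 <= (distance u h)%:E)%E.
  by rewrite lee_fin distance_ge0.
rewrite [X in (X + _)%E]mean_distanceE [X in (_ + X)%E]mean_distanceE.
apply: two_point_le => //.
- by move=> z; exact: play_bits_ge0.
- by move=> z; exact: play_bits_ge0.
move=> z; have := @play_bits_linear _ pol T z 1 1
  (fun h => (distance (optimum p) h)%:E) (fun h => (distance (optimum q) h)%:E)
  ler01 ler01 (D0 _) (mD _) (D0 _) (mD _).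
rewrite !mul1e => <-; apply: play_bits_ge.
- by rewrite lee_fin mulr_ge0.
- by apply: emeasurable_funD; apply: measurable_funeM.
- by move=> h; rewrite !mul1e -EFinD lee_fin distanceD_ge.
Qed.

Lemma optimum_dist_ge (p q : R) : 4^-1 <= p <= 3 / 4 -> 4^-1 <= q <= 3 / 4 ->
  p <= q -> 8 / 25 * (q - p) <= `|optimum p - optimum q|.
Proof.
move=> /andP[p0 p1] /andP[q0 q1] pq; apply: le_trans (ler_norm _).
have -> : optimum p - optimum q = 2 * (q - p) / ((1 + 2 * p) * (1 + 2 * q)).
  by rewrite /optimum; field; rewrite !gt_eqF//; lra.
rewrite ler_pdivlMr; last by nra.
have : (1 + 2 * p) * (1 + 2 * q) <= 25 / 4 by nra.
have : 0 <= q - p by lra.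
nra.
Qed.

(** Round by round: below the optimum the distance is the gap, and above it the violation is at
    least [slope p >= 3/8] times the distance. *)
Lemma regret_ge_mean_distance (p : R) (hp : 4^-1 <= p <= 3 / 4) T :
  ((3 / 8)%:E * mean_distance hp T <=
   'E_(interaction_law (I := hard_slb hp) pol T)[@efficacy_regret R (hard_slb hp) T] +
   'E_(interaction_law (I := hard_slb hp) pol T)[@safety_violation R (hard_slb hp) T])%E.
Proof.
have mE := @measurable_efficacy_regret R (hard_slb hp) T.
have mS := @measurable_safety_violation R (hard_slb hp) T.
have E0 h : 0 <= efficacy_regret (I := hard_slb hp) (T := T) h.
  by apply: sumr_ge0 => t _; rewrite le_max lexx orbT.
have S0 h : 0 <= safety_violation (I := hard_slb hp) (T := T) h.
  by apply: sumr_ge0 => t _; rewrite le_max lexx orbT.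
rewrite unlock /mean_distance -ge0_integralD//; first last.
- by apply/measurable_EFinP.
- by move=> h _; rewrite lee_fin.
- by apply/measurable_EFinP.
- by move=> h _; rewrite lee_fin.
rewrite -ge0_integralZl//; first last.
- by move=> h _; rewrite lee_fin distance_ge0.
- exact: measurable_distance.
apply: ge0_le_integral => //.
- by move=> h _; rewrite -EFinM lee_fin mulr_ge0// distance_ge0.
- by apply: measurable_funeM; exact: measurable_distance.
- by apply: emeasurable_funD; apply/measurable_EFinP.
move=> h _; rewrite -EFinM -EFinD lee_fin.
rewrite /distance /efficacy_regret /safety_violation mulr_sumr -big_split /=.
apply: ler_sum => t _; set x := (tnth h t).1.
have [p0 p1] := andP hp.
have v := violation_hard_ge hp x.
rewrite gap_hard.
have g : slope p >= 3 / 8 by rewrite /slope; lra.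
set X := tnth x ord0 in v *; set u := optimum p in v *.
have g1 : u - X <= Num.max (u - X) 0 by rewrite le_max lexx.
have g0 : 0 <= Num.max (u - X) 0 by rewrite le_max lexx orbT.
have v1 : violation (I := hard_slb hp) x <= Num.max (violation (I := hard_slb hp) x) 0.
  by rewrite le_max lexx.
have v0 : 0 <= Num.max (violation (I := hard_slb hp) x) 0 by rewrite le_max lexx orbT.
have [Xu|uX] := leP X u; first by rewrite ler0_norm; lra.
rewrite gtr0_norm; last lra.
have : 3 / 8 * (X - u) <= slope p * (X - u) by apply: ler_wpM2r; lra.
lra.
Qed.

Lemma exists_hard_parameter : exists p (hp : 4^-1 <= p <= 3 / 4),
  forall k, ((4 ^+ k / 100)%:E <= mean_distance hp (16 ^ k))%E.
Proof.
pose bad k : set R := [set p | exists hp : 4^-1 <= p <= 3 / 4,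
  (mean_distance hp (16 ^ k) < (4 ^+ k / 100)%:E)%E].
(* The starting window is [[1/4, 1/2]]. At horizon [T = 16 ^ k] its width [1 / (4 * 4 ^ k)] is
   exactly [1 / (4 sqrt T)], as the overlap requires. Two bad points at least half a width apart
   would have mean distances adding up to at least [16 ^ k * (8/25) * (1/8) / 4 ^ k / 2 = 4 ^ k /
   50], twice the threshold. *)
have [|k p q lp qr pqge pqle [hp bp] [hq bq]|p pw gp] :=
    @nested_windows R bad 4^-1 4^-1.
- by [].
- have k0 : 0 < 4 ^+ k :> R by rewrite exprn_gt0.
  have sq : (16 ^ k)%:R = (4 ^+ k) ^+ 2 :> R.
    by rewrite natrX -exprM mulnC exprM expr2 -natrM.
  have npq : (16 ^ k)%:R * (q - p) ^+ 2 <= 16^-1 :> R.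
    have -> : 16^-1 = 4^-1 ^+ 2 :> R by field.
    rewrite sq -exprMn.
    move: pqle; rewrite ler_pdivlMr// => pqle.
    have qp : 0 <= q - p by apply: le_trans pqge; rewrite !divr_ge0// ltW.
    apply: lerXn2r; rewrite ?nnegrE; [|lra|by rewrite mulrC].
    by rewrite mulr_ge0// ltW.
  have := mean_distance_two_point hp hq npq.
  have pq : p <= q.
    by rewrite -subr_ge0; apply: le_trans pqge; rewrite !divr_ge0// ltW.
  have od := optimum_dist_ge hp hq pq.
  apply/negP; rewrite -ltNge; apply: lt_le_trans (lteD bp bq) _.
  rewrite -EFinD lee_fin sq.
  move: pqge; rewrite ler_pdivrMr// => pqge.
  have : 4 ^+ k * (8 / 25 * (q - p)) <= 4 ^+ k * `|optimum p - optimum q|.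
    by rewrite ler_pM2l.
  move=> od'.
  have : 4 ^+ k * (25^-1) <= 4 ^+ k * (4 ^+ k * `|optimum p - optimum q|).
    by rewrite ler_pM2l//; lra.
  rewrite expr2 -!mulrA; lra.
have hp : 4^-1 <= p <= 3 / 4 by lra.
exists p, hp => k; rewrite leNgt; apply/negP => lt; apply: (gp k).
by exists hp.
Qed.

End distance_to_optimum.

(** * The square-root lower bound at every horizon *)

Theorem theorem5p1 (R : realType) :
  exists (c : R) (T0 : nat), 0 < c /\
    forall alg : slb_algorithm R, exists I : slb_instance R,
      well_separated I (1 / 8) /\
      forall T : nat, (T0 <= T)%N ->
        ((c * Num.sqrt T%:R)%:E <=
         maxe ('E_(interaction_law (alg (known I)) T)[@efficacy_regret R I T])
              ('E_(interaction_law (alg (known I)) T)[@safety_violation R I T]))%E.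
Proof.
(* The constant is [3/8 * 1/100], halved to pass from the sum to the maximum, and divided by [4] for
   rounding [T] down to a power of [16]; such a power exists once [T >= 1]. *)
exists (3 / 6400), 1%N; split; first by lra.
move=> alg; have [p [hp lb]] := exists_hard_parameter (alg (hard_known R)).
exists (hard_slb hp); split; first exact: hard_slb_well_separated.
move=> T T1; have := regret_ge_mean_distance (alg (hard_known R)) hp T.
set E := 'E_ _[_]%E; set S := 'E_ _[_]%E => ES.
pose k := trunc_log 16 T.
have kT : (16 ^ k <= T)%N by rewrite trunc_logP.
have Tk : (T < 16 ^ k.+1)%N by rewrite trunc_log_ltn.
have sT : Num.sqrt T%:R <= 4 * 4 ^+ k :> R.
  have -> : 4 * 4 ^+ k = Num.sqrt (16 ^ k.+1)%:R :> R.
    rewrite -exprS natrX (_ : 16%:R = 4 ^+ 2 :> R); last by rewrite expr2 -natrM.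
    by rewrite exprAC sqrtr_sqr ger0_norm// exprn_ge0.
  by rewrite ler_sqrt ?ler_nat// ltnW.
have {}ES : ((3 / 800 * 4 ^+ k)%:E <= E + S)%E.
  apply: le_trans ES.
  have -> : 3 / 800 * 4 ^+ k = 3 / 8 * (4 ^+ k / 100) :> R by field.
  rewrite EFinM; apply: lee_wpmul2l; first by rewrite lee_fin; lra.
  exact: le_trans (lb k) (mean_distance_le _ _ kT).
apply: (@le_trans _ _ (3 / 1600 * 4 ^+ k)%:E); first by rewrite lee_fin; lra.
rewrite leNgt gt_max; apply/negP => /andP[Elt Slt].
have := le_lt_trans ES (lteD Elt Slt).
by rewrite -EFinD lte_fin; lra.
Qed.
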